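(* For every positive integer $m$, there exists a $12m$-tuple $A_m$ of elements of $\mathbb{Z}/m\mathbb{Z}$ such that, for every non-negative integer $\lambda$, the Steinhaus triangle modulo $m$ whose first row is $A_m^{\lambda}$ (the tuple $A_m$ repeated $\lambda$ times, of length $12\lambda m$) is balanced.
   Context: Let $T_n=\{(i,j)\in\mathbb{N}^2 : i+j<n\}$. A Steinhaus triangle modulo $m$ of size $n$ is a family $(a_{i,j})_{(i,j)\in T_n}$ of elements of $\mathbb{Z}/m\mathbb{Z}$ satisfying $a_{i,j}=a_{i-1,j}+a_{i-1,j+1}$ for all $(i,j)\in T_n$ with $i\ge 1$; it is determined by its first row $(a_{0,j})_{j=0}^{n-1}$. It is called balanced if every element of $\mathbb{Z}/m\mathbb{Z}$ occurs the same number of times among its $n(n+1)/2$ entries (the empty triangle, $n=0$, is balanced). *)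

(* Defs.v *)
From mathcomp Require Import all_boot.
Set Implicit Arguments.
Unset Strict Implicit.
Unset Printing Implicit Defensive.

(* Z/mZ (m > 0) is represented by 'I_m, i.e. residues 0..m-1, with addition
   modulo m.  Entries a_{i,j} of the Steinhaus triangle are stored as these
   residues (natural numbers < m). *)

Fixpoint steinhaus_entry (m : nat) (s : seq nat) (i j : nat) : nat :=
  match i with
  | 0 => nth 0 s j
  | i'.+1 => (steinhaus_entry m s i' j + steinhaus_entry m s i' j.+1) %% m
  end.

Definition steinhaus_entries (m : nat) (s : seq nat) : seq nat :=
  let n := size s in
  [seq steinhaus_entry m s i j | i <- iota 0 n, j <- iota 0 (n - i)].

Definition balanced_steinhaus (m : nat) (s : seq 'I_m) : Prop :=
  exists c : nat, forall x : 'I_m,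
    count_mem (x : nat) (steinhaus_entries m (map val s)) = c.

Definition rep_seq (T : Type) (lambda : nat) (s : seq T) : seq T :=
  flatten (nseq lambda s).

(* Main.v *)
Require Import Defs.
From mathcomp Require Import all_boot.
From mathcomp Require Import all_order all_algebra zify ring.

(** Work with integer arrays satisfying Pascal's rule.  For m = 2^k q with q odd,
    the array is [alpha * dyadic + 2^k * universal], where [alpha] is 1 modulo 2^k
    and 0 modulo q; it reduces to [dyadic] modulo 2^k and to a multiple of
    [universal] modulo q.

    Equidistribution is lifted from a divisor D of M to M by showing that the
    number of entries congruent to v modulo M is invariant under v -> v + D.  For
    this the triangle is cut along a lattice T Z^2 on which the array is doubly
    arithmetic modulo M, with steps u and v; a triangle x + k u + l v contributes
    nothing to the difference of the two counts as soon as D is a multiple modulo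
    M of each of the three side steps u, v and u - v.

    The triangles of [universal] are not balanced modulo 2, so another array is
    needed modulo 2^k.  The first row of [dyadic] is a linear recurrence whose
    characteristic polynomial is (x^2 + x + 1)^5 modulo 2, so that 12 * 2^n steps in either direction change
    it by 2^(n-2) times a fixed array (the slope) modulo 2^(n+3).  The
    coefficients and initial values were found by computer search so that the
    slopes in the three directions are never divisible by 32, which gives the
    step from 2^(k-1) to 2^k for every k >= 5, and so that the cases k <= 4 hold;
    these facts are finite computations on the residues modulo 64. *)

Set Implicit Arguments.
Unset Strict Implicit.
Unset Printing Implicit Defensive.

Import GRing.Theory Num.Theory.
Local Open Scope ring_scope.

(** * Arithmetic triangles *)

Section ArithmeticTriangles.

Variables (M h : int) (psi : int -> int).
Hypothesis psi_per : forall x y, (M %| x - y)%Z -> psi x = psi y.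

Let phi x := psi x - psi (x + h).

(** The points x, x + d, ..., x + (N - 1) d form a closed cycle modulo [M], possibly with
    repetitions, and translation by [h] amounts to [w] steps along it. *)
Definition full_direction (N : nat) (d : int) :=
  (M %| N%:Z * d)%Z /\ exists w : nat, (M %| w%:Z * d - h)%Z.

Lemma sum_shift_period (f : nat -> int) (N : nat) :
  (forall k, f (k + N)%N = f k) ->
  forall w, \sum_(k < N) f (k + w)%N = \sum_(k < N) f k.
Proof.
move=> fN; elim=> [|w IH]; first by apply: eq_bigr => k _; rewrite addn0.
rewrite -IH; case: N fN {IH} => [|N] fN; first by rewrite !big_ord0.
rewrite big_ord_recr big_ord_recl /= addrC; congr (_ + _).
  by rewrite add0n -(fN w); congr f; lia.
by apply: eq_bigr => k _; congr f; rewrite /bump /=; lia.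
Qed.

Lemma sum_full_direction N d x :
  full_direction N d -> \sum_(k < N) phi (x + k%:Z * d) = 0.
Proof.
case=> /dvdzP[c Nd] [w /dvdzP[e wd]]; rewrite /phi sumrB; apply/eqP.
rewrite subr_eq0 eq_sym; apply/eqP.
rewrite -[RHS](@sum_shift_period (fun k => psi (x + k%:Z * d)) N _ w) => [|k].
  by apply: eq_bigr => k _; apply: psi_per; apply/dvdzP; exists (- e); lia.
by apply: psi_per; apply/dvdzP; exists c; lia.
Qed.

(* Moving the base point by v replaces one side of the triangle by another, and
   both have zero sum; so the sum G is v-periodic, while its average over N steps
   along v vanishes. *)
Lemma sum_arithmetic_triangle (N e : nat) (x u v : int) : (e <= 1)%N ->
    full_direction N u -> full_direction N v -> full_direction N (u - v) ->
  \sum_(k < N) \sum_(l < N - e - k) phi (x + k%:Z * u + l%:Z * v) = 0.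
Proof.
move=> e1 Du Dv Duv.
pose G y := \sum_(k < N) \sum_(l < N - e - k) phi (y + k%:Z * u + l%:Z * v).
have Gv y : G (y + v) = G y.
  apply/eqP; rewrite -subr_eq0 /G -sumrB.
  (* For each [k] the sum over [l] telescopes to a point of the hypotenuse minus a point of the side
     along [u]. Since [e <= 1], both sides still have [N] points; for [e = 1] the last pair
     cancels. *)
  rewrite (eq_bigr (fun k : 'I_N =>
    phi (y + (N - e)%N%:Z * v + k%:Z * (u - v)) - phi (y + k%:Z * u))).
    by rewrite sumrB !sum_full_direction.
  move=> k _; pose g l := phi (y + k%:Z * u + l%:Z * v).
  rewrite (eq_bigr (fun l : 'I_(N - e - k) => g l.+1)) => [|l _]; last first.
    by rewrite /g; congr phi; lia.
  rewrite -sumrB -(big_mkord xpredT (fun l => g l.+1 - g l)).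
  rewrite telescope_sumr //.
  have kN := ltn_ord k.
  have -> : (N - e)%N%:Z = (N - e - k)%N%:Z + k%:Z by lia.
  by rewrite /g; congr (phi _ - phi _); ring.
have Grv y r : G (y + r%:Z * v) = G y.
  elim: r => [|r IH]; first by congr G; ring.
  by rewrite -[RHS]IH -[RHS]Gv -addn1 PoszD; congr G; ring.
have: \sum_(r < N) G (x + r%:Z * v) = 0.
  rewrite /G exchange_big big1 //= => k _; rewrite exchange_big big1 //= => l _.
  rewrite -[RHS](sum_full_direction (x + k%:Z * u + l%:Z * v) Dv).
  by apply: eq_bigr => r _; congr phi; ring.
rewrite (eq_bigr _ (fun (r : 'I_N) _ => Grv x r)) sumr_const card_ord.
move/eqP; rewrite mulrn_eq0 => /orP[/eqP N0|/eqP //].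
by rewrite N0 big_ord0.
Qed.

End ArithmeticTriangles.

(** * Cutting a triangle along a lattice *)

Definition triangle_sum (n : nat) (F : nat -> nat -> int) : int :=
  \sum_(i < n) \sum_(j < n - i) F i j.

Lemma sum_blocks (T N : nat) (g : nat -> int) :
  \sum_(i < T * N) g i = \sum_(r < T) \sum_(k < N) g (T * k + r)%N.
Proof.
rewrite exchange_big /=; elim: N => [|N IH]; first by rewrite muln0 !big_ord0.
by rewrite big_ord_recr /= -IH mulnSr big_split_ord.
Qed.

Lemma sum_truncate (n p : nat) (g : nat -> int) : (p <= n)%N ->
  \sum_(j < p) g j = \sum_(j < n) g j *+ (j < p)%N.
Proof.
move=> le_pn; rewrite (big_ord_widen n g le_pn) big_mkcond.
by apply: eq_bigr => j _; case: (_ < _)%N; rewrite ?mulr1n ?mulr0n.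
Qed.

(** For r, c < T, the condition T k + r + T l + c < T N means k + l < N if r + c < T, and k + l < N
    - 1 otherwise. These are the two values of [e] in [sum_arithmetic_triangle]. *)
Lemma triangle_sum_blocks (T N : nat) (F : nat -> nat -> int) :
  triangle_sum (T * N) F =
  \sum_(r < T) \sum_(c < T) \sum_(k < N) \sum_(l < N - (T <= r + c)%N - k)
    F (T * k + r)%N (T * l + c)%N.
Proof.
rewrite /triangle_sum (sum_blocks T N (fun i => \sum_(j < T * N - i) F i j)).
apply: eq_bigr => r _.
rewrite exchange_big /=; apply: eq_bigr => k _.
rewrite (@sum_truncate (T * N) _ (F (T * k + r)%N)) ?leq_subr //.
rewrite (sum_blocks T N (fun j => F (T * k + r)%N j *+ (j < T * N - (T * k + r))%N)).
apply: eq_bigr => c _.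
rewrite (@sum_truncate N _ (fun l => F (T * k + r)%N (T * l + c)%N)); last by lia.
apply: eq_bigr => l _; congr (_ *+ nat_of_bool _).
have := ltn_ord r; have := ltn_ord c; have := ltn_ord k; have := ltn_ord l.
by case: (leqP T (r + c)) => ?; nia.
Qed.

(** * Counting residues *)

Definition residue_count (M : int) (s : nat -> nat -> int) (n : nat) (v : int) :=
  triangle_sum n (fun i j => (M %| s i j - v)%Z%:Z).

Definition equidistributed (M : int) (s : nat -> nat -> int) (n : nat) :=
  forall v w, residue_count M s n v = residue_count M s n w.

Lemma dvdz_progression (M d : int) (f : nat -> int) :
  (forall k, (M %| f k.+1 - f k - d)%Z) ->
  forall k, (M %| f k - f 0%N - k%:Z * d)%Z.
Proof.
move=> fS; elim=> [|k IH]; first by rewrite mul0r subr0 subrr dvdz0.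
have -> : f k.+1 - f 0%N - k.+1%:Z * d
        = (f k.+1 - f k - d) + (f k - f 0%N - k%:Z * d).
  by rewrite -addn1 PoszD; ring.
by rewrite rpredD.
Qed.

Lemma dvdz_multiples (M : int) (T : nat) (s : nat -> nat -> int) :
    (forall i j, (M %| s (i + T)%N j - s i j)%Z) ->
    (forall i j, (M %| s i (j + T)%N - s i j)%Z) ->
  forall a b i j, (M %| s (i + T * a)%N (j + T * b)%N - s i j)%Z.
Proof.
move=> si sj a b i j; rewrite -(subrK (s i (j + T * b)%N) (s _ _)) -addrA rpredD //.
  have := @dvdz_progression M 0 (fun k => s (i + T * k)%N (j + T * b)%N).
  rewrite muln0 addn0 => /(_ _ a); rewrite mulr0 subr0; apply=> k.
  by rewrite subr0 mulnSr addnA.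
have := @dvdz_progression M 0 (fun k => s i (j + T * k)%N).
rewrite muln0 addn0 => /(_ _ b); rewrite mulr0 subr0; apply=> k.
by rewrite subr0 mulnSr addnA.
Qed.

Lemma dvdz_congr (M x y : int) : (M %| x - y)%Z -> (M %| x)%Z = (M %| y)%Z.
Proof. by move=> Mxy; rewrite -[x](subrK y) rpredDl. Qed.

(** Each class of positions modulo [T] carries an arithmetic triangle. The indicator of the residue
    [w] taken at x + h is that of w - h at x, so every class contributes zero to the difference of
    the counts. *)
Lemma residue_count_shift (M h : int) (s u v : nat -> nat -> int) (T N : nat) :
    (forall r c k l, (r < T)%N -> (c < T)%N ->
      (M %| s (T * k + r)%N (T * l + c)%N
            - (s r c + k%:Z * u r c + l%:Z * v r c))%Z) ->
    (forall r c, (r < T)%N -> (c < T)%N ->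
      [/\ full_direction M h N (u r c), full_direction M h N (v r c)
        & full_direction M h N (u r c - v r c)]) ->
  forall w, residue_count M s (T * N) w = residue_count M s (T * N) (w - h).
Proof.
move=> sT dirs w; apply/eqP; rewrite -subr_eq0 /residue_count !triangle_sum_blocks.
rewrite -sumrB big1 // => r _; rewrite -sumrB big1 // => c _.
have [ur vr uvr] := dirs r c (ltn_ord r) (ltn_ord c).
pose psi x := (M %| x - w)%Z%:Z.
have psiM x y : (M %| x - y)%Z -> psi x = psi y.
  by move=> Mxy; rewrite /psi (@dvdz_congr M (x - w) (y - w)) //; congr (_ %| _)%Z: Mxy; ring.
rewrite -[RHS](@sum_arithmetic_triangle M h psi psiM N (T <= r + c)%N (s r c)
                (u r c) (v r c)) ?leq_b1 //.
rewrite -sumrB; apply: eq_bigr => k _; rewrite -sumrB; apply: eq_bigr => l _.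
have Ms := sT r c k l (ltn_ord r) (ltn_ord c).
by rewrite /psi; congr (_%:Z - _%:Z); congr nat_of_bool; apply: dvdz_congr;
   congr (_ %| _)%Z: Ms; ring.
Qed.

(** If x = y D, exactly one r < q makes (y + r) D divisible by D q, namely the residue of -y modulo
    [q]. *)
Lemma sum_coset_indicator (D : int) (q : nat) (x : int) : D != 0 -> (0 < q)%N ->
  \sum_(r < q) (D * q%:Z %| x + r%:Z * D)%Z%:Z = (D %| x)%Z%:Z.
Proof.
move=> D0 q0; have [/dvdzP[y ->]|Dx] := boolP (D %| x)%Z; last first.
  rewrite big1 // => r _; have [/dvdzP[e xe]|//] := boolP (_ %| _)%Z.
  by case/negP: Dx; apply/dvdzP; exists (e * q%:Z - r%:Z);
     rewrite mulrBl -mulrA (mulrC q%:Z) -xe; ring.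
have q0z : q%:Z != 0 by rewrite eqz_nat -lt0n.
have r0q : (`|((- y) %% q%:Z)%Z| < q)%N.
  by have := ltz_pmod (- y) (_ : 0 < q%:Z); have := modz_ge0 (- y) q0z; lia.
have dvdE (r : 'I_q) : (D * q%:Z %| y * D + r%:Z * D)%Z = (r == Ordinal r0q).
  rewrite -mulrDl [X in (_ %| X)%Z]mulrC dvdz_mul2l //.
  apply/idP/eqP => [/dvdzP[e ye]|->] /=.
    apply: val_inj => /=; have -> : - y = - e * q%:Z + r%:Z by lia.
    by rewrite modzMDl modz_small ?absz_nat //; have := ltn_ord r; lia.
  rewrite gez0_abs ?modz_ge0 //; apply/dvdzP; exists (- ((- y) %/ q%:Z)%Z).
  by have := divz_eq (- y) q%:Z; lia.
rewrite (bigD1 (Ordinal r0q)) // dvdE eqxx big1 ?addr0 ?dvdz_mull //.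
by move=> r /negbTE r_neq; rewrite dvdE r_neq.
Qed.

(** A residue modulo D has [q] lifts modulo D q, whose counts agree by shift invariance. Its count
    is thus [q] times that of any lift, and [q] cancels. *)
Lemma equidistributed_lift (D : int) (q n : nat) (s : nat -> nat -> int) :
    D != 0 -> (0 < q)%N -> equidistributed D s n ->
    (forall w, residue_count (D * q%:Z) s n w
             = residue_count (D * q%:Z) s n (w - D)) ->
  equidistributed (D * q%:Z) s n.
Proof.
move=> D0 q0 eqD shiftD v w.
have shiftrD x r : residue_count (D * q%:Z) s n (x - r%:Z * D)
                 = residue_count (D * q%:Z) s n x.
  elim: r => [|r IH]; first by congr residue_count; ring.
  by rewrite -IH [RHS]shiftD -addn1 PoszD; congr residue_count; ring.
have countD x : residue_count D s n x = residue_count (D * q%:Z) s n x *+ q.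
  transitivity (\sum_(r < q) residue_count (D * q%:Z) s n (x - r%:Z * D)).
    rewrite /residue_count /triangle_sum.
    rewrite exchange_big; apply: eq_bigr => i _.
    rewrite exchange_big; apply: eq_bigr => j _ /=.
    rewrite -[LHS](sum_coset_indicator _ D0 q0); apply: eq_bigr => r _.
    by congr (nat_of_bool (_ %| _)%Z)%:Z; ring.
  rewrite (eq_bigr (fun=> residue_count (D * q%:Z) s n x)) => [|r _].
    by rewrite sumr_const card_ord.
  exact: shiftrD.
have := eqD v w; rewrite !countD => /eqP; rewrite -subr_eq0 -mulrnBl mulrn_eq0.
by rewrite subr_eq0 => /orP[/eqP q_eq0|/eqP //]; rewrite q_eq0 in q0.
Qed.

Definition lower_count (M : int) (s : nat -> nat -> int) (T : nat) (v : int) :=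
  \sum_(r < T) \sum_(c < T) (M %| s r c - v)%Z%:Z *+ (r + c < T)%N.

Definition upper_count (M : int) (s : nat -> nat -> int) (T : nat) (v : int) :=
  \sum_(r < T) \sum_(c < T) (M %| s r c - v)%Z%:Z *+ (T <= r + c)%N.

(** The triangle of size T N is tiled by N (N + 1) / 2 translates of the lower triangle of a period
    square and N (N - 1) / 2 translates of the complementary upper one. *)
Lemma equidistributed_periodic (M : int) (s : nat -> nat -> int) (T : nat) :
    (forall i j, (M %| s (i + T)%N j - s i j)%Z) ->
    (forall i j, (M %| s i (j + T)%N - s i j)%Z) ->
    (forall v w, lower_count M s T v = lower_count M s T w) ->
    (forall v w, upper_count M s T v = upper_count M s T w) ->
  forall N, equidistributed M s (T * N).
Proof.
move=> sTi sTj lo up N.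
have sT r c k l : (M %| s (T * k + r)%N (T * l + c)%N - s r c)%Z.
  by rewrite ![(T * _ + _)%N]addnC; apply: dvdz_multiples.
pose W (e : bool) : nat := \sum_(k < N) (N - e - k)%N.
suff countE v : residue_count M s (T * N) v
    = lower_count M s T v *+ W false + upper_count M s T v *+ W true.
  by move=> v w; rewrite !countE (lo v w) (up v w).
rewrite /residue_count triangle_sum_blocks /lower_count /upper_count.
rewrite -!sumrMnl -big_split; apply: eq_bigr => r _ /=.
rewrite -!sumrMnl -big_split; apply: eq_bigr => c _ /=.
set x := (M %| s r c - v)%Z%:Z.
transitivity (x *+ W (T <= r + c)%N).
  rewrite /W -sumrMnr; apply: eq_bigr => k _.
  rewrite -[X in _ *+ X]card_ord -sumr_const; apply: eq_bigr => l _.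
  rewrite /x; congr (nat_of_bool _)%:Z; apply: dvdz_congr.
  by congr (_ %| _)%Z: (sT r c k l); ring.
by rewrite ltnNge; case: (T <= r + c)%N; rewrite ?mulr1n ?mulr0n ?mul0rn ?add0r ?addr0.
Qed.

(** * The recurrence *)

Definition pascal (s : nat -> nat -> int) :=
  forall i j, s i.+1 j = s i j + s i j.+1.

(** Stating the recurrence in every row makes the class visibly closed under shifts in both
    directions, so the difference arrays below stay in it. *)
Definition regular (s : nat -> nat -> int) := pascal s /\ forall i j,
  7 * s i j - s i (j + 1)%N + 7 * s i (j + 2)%N + 5 * s i (j + 4)%N
  + s i (j + 5)%N - 5 * s i (j + 6)%N + 6 * s i (j + 7)%N + 3 * s i (j + 8)%N
  - 7 * s i (j + 9)%N + s i (j + 10)%N = 0.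

Lemma regular_shift (s : nat -> nat -> int) p q :
  regular s -> regular (fun i j => s (i + p)%N (j + q)%N).
Proof.
case=> sP sR; split=> [i j|i j]; first by rewrite addSn sP addSn.
have := sR (i + p)%N (j + q)%N.
by rewrite -!addnA ![(q + _)%N]addnC !addnA.
Qed.

Lemma regular_sub (s t : nat -> nat -> int) :
  regular s -> regular t -> regular (fun i j => s i j - t i j).
Proof.
case=> sP sR [tP tR]; split=> [i j|i j]; first by rewrite sP tP; ring.
by have := sR i j; have := tR i j; lia.
Qed.

Lemma regular_add (s t : nat -> nat -> int) :
  regular s -> regular t -> regular (fun i j => s i j + t i j).
Proof.
case=> sP sR [tP tR]; split=> [i j|i j]; first by rewrite sP tP; ring.
by have := sR i j; have := tR i j; lia.
Qed.

Lemma regular_scale (d : int) (s : nat -> nat -> int) :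
  regular s -> regular (fun i j => d * s i j).
Proof.
case=> sP sR; split=> [i j|i j]; first by rewrite sP; ring.
by rewrite -[RHS](mulr0 d) -(sR i j); ring.
Qed.

Lemma regular_div (d : int) (s : nat -> nat -> int) :
    d != 0 -> regular s -> (forall i j, (d %| s i j)%Z) ->
  exists2 t, regular t & forall i j, s i j = d * t i j.
Proof.
move=> d0 [sP sR] ds; pose t i j := (s i j %/ d)%Z.
have st i j : s i j = d * t i j by rewrite mulrC divzK.
exists t => //; split=> [i j|i j]; apply: (mulfI d0).
  by rewrite mulrDr -!st sP.
by rewrite mulr0 -(sR i j) !st; ring.
Qed.

(** The recurrence is monic of order 10, so ten entries generate row 0 over the integers and
    Pascal's rule does the rest. Divisibility of a whole array becomes ten checks. *)
Lemma regular_dvd (M : int) (s : nat -> nat -> int) :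
    regular s -> (forall j, (j < 10)%N -> (M %| s 0%N j)%Z) ->
  forall i j, (M %| s i j)%Z.
Proof.
case=> sP sR s0; elim=> [|i IH] j; last by rewrite sP rpredD.
elim/ltn_ind: j => j IH; have [/s0 //|j_ge] := ltnP j 10.
have := sR 0%N (j - 10)%N; rewrite subnK // => sj.
have -> : s 0%N j = - (7 * s 0%N (j - 10)%N - s 0%N (j - 10 + 1)%N
  + 7 * s 0%N (j - 10 + 2)%N + 5 * s 0%N (j - 10 + 4)%N + s 0%N (j - 10 + 5)%N
  - 5 * s 0%N (j - 10 + 6)%N + 6 * s 0%N (j - 10 + 7)%N
  + 3 * s 0%N (j - 10 + 8)%N - 7 * s 0%N (j - 10 + 9)%N) by lia.
by rewrite rpredN !(rpredD, rpredB) // ?dvdz_mull ?rpredN ?dvdz_mull ?IH //; lia.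
Qed.

(* Modulo 2 the characteristic polynomial is f^5 with f = x^2 + x + 1, and f^8 is
   both x^16 + x^8 + 1 and y^16 + y^8 + 1 for y = 1 + x; hence x^24 = y^24 = 1. *)
Lemma regular_octuple (s : nat -> nat -> int) : regular s ->
  forall i j, (2 %| s i j + s i (j + 8)%N + s i (j + 16)%N)%Z.
Proof.
case=> _ sR i j.
pose y k := s i (j + k)%N.
have R k : 7 * y k - y k.+1 + 7 * y k.+2 + 5 * y k.+4 + y k.+4.+1 - 5 * y k.+4.+2
    + 6 * y k.+4.+3 + 3 * y k.+4.+4 - 7 * y k.+4.+4.+1 + y k.+4.+4.+2 = 0.
  by have := sR i (j + k)%N; rewrite /y !addnS !addn0.
(* f^8 = f^5 f^3 and f^3 has degree 6, hence seven consecutive instances. *)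
have := (R 0%N, R 1%N, R 2%N, R 3%N, R 4%N, R 5%N, R 6%N).
have -> : s i j = y 0%N by rewrite /y addn0.
rewrite -/(y 8%N) -/(y 16%N); move: y {R} => y [[[[[[R0 R1] R2] R3] R4] R5] R6].
lia.
Qed.

(** With x the shift along rows, going down one row is multiplication by 1 + x, and (1 + x)^(2^e) =
    1 + x^(2^e) modulo 2. *)
Lemma pascal_frobenius (s : nat -> nat -> int) (e : nat) : pascal s ->
  forall i j, (2 %| s (i + 2 ^ e)%N j - s i j - s i (j + 2 ^ e)%N)%Z.
Proof.
move=> sP; elim: e => [|e IH] i j.
  by rewrite expn0 !addn1 sP (_ : _ - _ - _ = 0); [exact: dvdz0 | ring].
rewrite expnS mul2n -addnn !addnA.
have := (IH (i + 2 ^ e)%N j, IH i j, IH i (j + 2 ^ e)%N).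
by move=> [[/dvdzP[a A] /dvdzP[b B]] /dvdzP[c C]];
   apply/dvdzP; exists (a + b + c + s i (j + 2 ^ e)%N); lia.
Qed.

Lemma regular_period2 (s : nat -> nat -> int) : regular s ->
  forall p q i j, (2 %| s (i + 24 * p)%N (j + 24 * q)%N - s i j)%Z.
Proof.
move=> sreg; have [sP _] := sreg; have oct := regular_octuple sreg.
have row i j : (2 %| s i (j + 24)%N - s i j)%Z.
  have := oct i (j + 8)%N; have := oct i j.
  rewrite -!addnA (_ : 8 + 8 = 16)%N // (_ : 8 + 16 = 24)%N //.
  by move=> /dvdzP[a A] /dvdzP[b B]; apply/dvdzP; exists (b - a); lia.
(* y^24 = y^16 y^8 = (1 + x^16)(1 + x^8) = (1 + x^8 + x^16) + x^24 = x^24 modulo 2. *)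
have col i j : (2 %| s (i + 24)%N j - s i j)%Z.
  have fr8 k l : (2 %| s (k + 8)%N l - s k l - s k (l + 8)%N)%Z :=
    @pascal_frobenius s 3 sP k l.
  have fr16 k l : (2 %| s (k + 16)%N l - s k l - s k (l + 16)%N)%Z :=
    @pascal_frobenius s 4 sP k l.
  have := (fr8 (i + 16)%N j, fr16 i j, fr16 i (j + 8)%N, oct i j, row i j).
  rewrite -!addnA (_ : 16 + 8 = 24)%N // (_ : 8 + 16 = 24)%N //.
  move=> [[[[]]]] /dvdzP[a A] /dvdzP[b B] /dvdzP[c C] /dvdzP[d D] /dvdzP[e E].
  by apply/dvdzP; exists (a + b + c + d + e); lia.
by move=> p q i j; apply: (dvdz_multiples col row).
Qed.

(* If (sigma - 1) s = 2^n b and (sigma - 1) b = 16 c for the shift sigma, then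
   (sigma^2 - 1) s = 2^(n+1) (b + 8 c), and the induction continues since
   sigma^2 - 1 kills c modulo 2. *)
Lemma regular_growth (s : nat -> nat -> int) (p q : nat) : regular s ->
    (forall i j, (4 %| s (i + 48 * p)%N (j + 48 * q)%N - s i j)%Z) ->
    (forall i j, (64 %| s (i + 96 * p)%N (j + 96 * q)%N
                        - 2 * s (i + 48 * p)%N (j + 48 * q)%N + s i j)%Z) ->
  forall n i j, (2 ^+ (n + 5) %| s (i + 48 * 2 ^ n * p)%N (j + 48 * 2 ^ n * q)%N - s i j
                   - 2 ^+ n * (s (i + 48 * p)%N (j + 48 * q)%N - s i j))%Z.
Proof.
move=> sreg s4 s64.
pose D (T : nat) (t : nat -> nat -> int) i j := t (i + T * p)%N (j + T * q)%N - t i j.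
have Dreg T t : regular t -> regular (D T t).
  by move=> treg; apply: regular_sub => //; apply: regular_shift.
have [b0 b0reg Db0] := regular_div (isT : 4 != 0 :> int) (Dreg 48%N s sreg) s4.
have D2 T t i j : D (2 * T)%N t i j = D T t (i + T * p)%N (j + T * q)%N + D T t i j.
  by rewrite /D -!addnA -!mulnDl addnn -mul2n; ring.
(* Here [b] is the slope divided by 4; knowing it modulo 8 gives the increment modulo 2^n 4 8 =
   2^(n+5). *)
suff Dn n : exists b, [/\ regular b, forall i j, D (48 * 2 ^ n)%N s i j = 2 ^+ n * 4 * b i j,
    forall i j, (8 %| b i j - b0 i j)%Z
  & forall i j, (16 %| D (48 * 2 ^ n)%N b i j)%Z].
  move=> n i j; have [b [_ Db /(_ i j)/dvdzP[c b_b0] _]] := Dn n.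
  rewrite -/(D (48 * 2 ^ n)%N s i j) -/(D 48%N s i j) Db Db0.
  apply/dvdzP; exists c; rewrite exprD.
  by rewrite -[b i j](subrK (b0 i j)) b_b0; ring.
elim: n => [|n [b [breg Db b_b0 Db16]]].
  exists b0; split=> [//|i j|i j|i j]; first by rewrite muln1 Db0; ring.
    by rewrite subrr dvdz0.
  (* The second difference, divisible by 64, is 4 times the difference of [b0]. *)
  have /dvdzP[c C] := s64 i j; apply/dvdzP; exists c; rewrite muln1.
  have := D2 48%N s i j; rewrite -[(2 * 48)%N]/96%N !Db0 {1}/D.
  have := Db0 i j; rewrite /D; lia.
have [c creg Dc] := regular_div (isT : 16 != 0 :> int) (Dreg _ _ breg) Db16.
exists (fun i j => b i j + 8 * c i j).
have T2 : (48 * 2 ^ n.+1 = 2 * (48 * 2 ^ n))%N by rewrite expnS mulnCA.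
split=> [|i j|i j|i j].
- by apply: regular_add => //; apply: regular_scale.
- have := Dc i j; rewrite {1}/D => /eqP; rewrite subr_eq => /eqP bT.
  by rewrite T2 D2 !Db bT exprS; ring.
- rewrite -addrA addrC -addrA rpredD //; last by rewrite addrC.
  by rewrite dvdz_mulr.
have /dvdzP[e ce] : (2 %| D (48 * 2 ^ n.+1)%N c i j)%Z.
  by rewrite (_ : 48 = 24 * 2)%N // -!mulnA /D -!mulnA regular_period2.
have -> : D (48 * 2 ^ n.+1)%N (fun i j => b i j + 8 * c i j) i j
    = D (48 * 2 ^ n.+1)%N b i j + 8 * D (48 * 2 ^ n.+1)%N c i j by rewrite /D; ring.
rewrite ce T2 D2 rpredD //; first by rewrite rpredD //; exact: Db16.
by apply/dvdzP; exists e; ring.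
Qed.

(** * The dyadic array and its residues modulo 64 *)

(** A state is a window of ten consecutive entries of row 0. *)
Definition next_state (x : seq int) : seq int :=
  rcons (behead x) (- (7 * x`_0 - x`_1 + 7 * x`_2 + 5 * x`_4 + x`_5 - 5 * x`_6
                       + 6 * x`_7 + 3 * x`_8 - 7 * x`_9)).

Definition init_state : seq int := [:: 1; -3; -3; 1; 4; 1; 0; 3; 1; -1].

Fixpoint dyadic (i j : nat) : int :=
  if i is i'.+1 then dyadic i' j + dyadic i' j.+1
  else (iter j next_state init_state)`_0.

Lemma size_state j : size (iter j next_state init_state) = 10%N.
Proof. by elim: j => //= j IH; rewrite size_rcons size_behead IH. Qed.

Lemma nth_state j k : (k < 10)%N ->
  (iter j next_state init_state)`_k = dyadic 0 (j + k).
Proof.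
elim: k j => [|k IH] j k10; first by rewrite addn0.
rewrite addnS -addSn -IH ?(ltnW k10) //= nth_rcons size_behead size_state.
by rewrite -ltnS k10 nth_behead.
Qed.

Lemma dyadic_regular : regular dyadic.
Proof.
split=> //; elim=> [|i IH] j; last first.
  by have := IH j; have := IH j.+1; rewrite /= !addSn; lia.
have := nth_state j.+1 (isT : 9 < 10)%N.
rewrite iterS {1}/next_state nth_rcons size_behead size_state ltnn eqxx.
by rewrite !nth_state // addn0 addSnnS => <-; ring.
Qed.

(** The recurrence on natural numbers, for fast evaluation. A negated entry appears as [64 - e],
    where the truncated subtraction is exact because entries stay below 64. *)
Definition next_state64 (x : seq nat) : seq nat :=
  let e := nth 0%N x in
  rcons (behead x)
    ((7 * (64 - e 0) + e 1 + 7 * (64 - e 2) + 5 * (64 - e 4) + (64 - e 5) + 5 * e 6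
      + 6 * (64 - e 7) + 3 * (64 - e 8) + 7 * e 9) %% 64)%N.

Definition init_state64 : seq nat := [:: 1; 61; 61; 1; 4; 1; 0; 3; 1; 63]%N.

Definition next_row64 (r : seq nat) : seq nat :=
  [seq (p.1 + p.2) %% 64 | p <- zip r (behead r)]%N.

(** Each row is one entry shorter than the one above, and the largest check, [k = 4], reads a full
    square of side 192: width 384 = 2 192 and 200 rows cover it. *)
Definition top_row64 : seq nat :=
  [seq head 0%N x | x <- traject next_state64 init_state64 384].

Definition table64 : seq (seq nat) := traject next_row64 top_row64 200.

Definition entry64 (i j : nat) : nat := nth 0%N (nth [::] table64 i) j.

Definition reduces_to (x : seq int) (y : seq nat) :=
  [/\ size x = 10%N, size y = 10%N, all (gtn 64) y
    & forall k, (64 %| x`_k - (nth 0%N y k)%:Z)%Z].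

Lemma next_state_reduces x y :
  reduces_to x y -> reduces_to (next_state x) (next_state64 y).
Proof.
case=> sx sy lt64 xy; split; rewrite ?size_rcons ?size_behead ?sx ?sy //.
  rewrite all_rcons /= ltn_pmod //=; case: y lt64 {sy xy} => //= z y.
  by case/andP.
move=> k; rewrite !nth_rcons !size_behead sx sy /=.
case: (ltngtP k 9) => [k9|k9|_]; [by rewrite !nth_behead | by [] |].
have e64 i : (nth 0%N y i <= 64)%N.
  have [i_lt|i_ge] := ltnP i (size y); last by rewrite nth_default.
  by have /allP/(_ _ (mem_nth 0%N i_lt))/ltnW := lt64.
have /dvdzP[c0 C0] := xy 0%N; have /dvdzP[c1 C1] := xy 1%N.
have /dvdzP[c2 C2] := xy 2%N; have /dvdzP[c4 C4] := xy 4%N.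
have /dvdzP[c5 C5] := xy 5%N; have /dvdzP[c6 C6] := xy 6%N.
have /dvdzP[c7 C7] := xy 7%N; have /dvdzP[c8 C8] := xy 8%N.
have /dvdzP[c9 C9] := xy 9%N.
have := (e64 0%N, e64 2%N, e64 4%N, e64 5%N, e64 7%N, e64 8%N).
move=> [[[[[l0 l2] l4] l5] l7] l8].
set X := (_ + _)%N; have XE := divn_eq X 64.
(* 29 = 7 + 7 + 5 + 1 + 6 + 3 counts the copies of 64 brought in by the terms [64 - e]. *)
apply/dvdzP; exists (c1 - 7 * c0 - 7 * c2 - 5 * c4 - c5 + 5 * c6 - 6 * c7
  - 3 * c8 + 7 * c9 + (X %/ 64)%N%:Z - 29).
move: (X %/ 64)%N (X %% 64)%N XE => d r; rewrite {}/X => XE.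
have E0 := canRL (subrK _) C0; have E1 := canRL (subrK _) C1.
have E2 := canRL (subrK _) C2; have E4 := canRL (subrK _) C4.
have E5 := canRL (subrK _) C5; have E6 := canRL (subrK _) C6.
have E7 := canRL (subrK _) C7; have E8 := canRL (subrK _) C8.
have E9 := canRL (subrK _) C9.
rewrite E0 E1 E2 E4 E5 E6 E7 E8 E9; move: l0 l2 l4 l5 l7 l8 XE; clear.
move: (nth _ y 0%N) (nth _ y 1%N) (nth _ y 2%N) (nth _ y 4%N) (nth _ y 5%N) (nth _ y 6%N).
move: (nth _ y 7%N) (nth _ y 8%N) (nth _ y 9%N) => y7 y8 y9 y0 y1 y2 y4 y5 y6.
lia.
Qed.

Lemma iter_state_reduces j :
  reduces_to (iter j next_state init_state) (iter j next_state64 init_state64).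
Proof.
elim: j => [|j IH]; last exact: next_state_reduces.
split=> // k; do 10?[case: k => [//|k]]; by rewrite !nth_default.
Qed.

Lemma nth_next_row64 (r : seq nat) j : (j.+1 < size r)%N ->
  nth 0%N (next_row64 r) j = ((nth 0%N r j + nth 0%N r j.+1) %% 64)%N.
Proof.
move=> jr; have sz : size r = (size (behead r)).+1.
  by case: r jr.
rewrite (nth_map (0%N, 0%N)) ?size_zip ?size_behead ?nth_zip_cond /=; last by lia.
by rewrite size_zip size_behead nth_behead (_ : (_ < _)%N); last by lia.
Qed.

Lemma size_next_row64 (r : seq nat) : size (next_row64 r) = (size r).-1.
Proof. by rewrite size_map size_zip size_behead; lia. Qed.

Lemma row64P i j : (i < 200)%N -> (i + j < 384)%N ->
  size (nth [::] table64 i) = (384 - i)%N /\ (64 %| dyadic i j - (entry64 i j)%:Z)%Z.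
Proof.
rewrite /entry64 => i200.
have -> : nth [::] table64 i = iter i next_row64 top_row64.
  by rewrite (set_nth_default top_row64) ?size_traject // nth_traject.
move: i200 => _.
elim: i j => [|i IH] j ij.
  rewrite -[iter 0 _ _]/top_row64 size_map size_traject (nth_map init_state64) ?size_traject //.
  rewrite nth_traject //; split=> //; have [_ _ _ /(_ 0%N)] := iter_state_reduces j.
  by rewrite nth0.
have [sz dj] := IH j (ltnW ij); have [|_ dj1] := IH j.+1; first by lia.
rewrite iterS size_next_row64 sz; split; first by lia.
rewrite nth_next_row64 ?sz; last by lia.
have [/dvdzP[a A] /dvdzP[b B]] := (dj, dj1).
set x := nth _ _ j in A *; set y := nth _ _ j.+1 in B *.
have := divn_eq (x + y)%N 64; move: (_ %/ _)%N (_ %% _)%N => d r xy.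
apply/dvdzP; exists (a + b + d%:Z); rewrite [dyadic _ _]/=.
by lia.
Qed.

(** First differences vanish modulo 4, and the row, mixed and column second differences modulo 64;
    ten columns suffice by [regular_dvd]. Sums on both sides avoid truncated subtraction. *)
Definition growth_check (t : seq (seq nat)) : bool :=
  let e i j := nth 0%N (nth [::] t i) j in
  all (fun j => [&& e 0 (j + 48) == e 0 j %[mod 4], e 48 j == e 0 j %[mod 4],
     e 0 (j + 96) + e 0 j == 2 * e 0 (j + 48) %[mod 64],
     e 48 (j + 48) + e 0 j == e 48 j + e 0 (j + 48) %[mod 64]
   & e 96 j + e 0 j == 2 * e 48 j %[mod 64]])%N (iota 0 10).

(** Slopes have period 48 in both directions modulo 64, so one block decides divisibility by 32
    everywhere. The third test concerns the difference of the two slopes, the direction of the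
    hypotenuse. *)
Definition slope_check (t : seq (seq nat)) : bool :=
  all (fun i => let r := nth [::] t i in let r' := nth [::] t (i + 48) in
    all (fun j => let x := nth 0%N r j in
      let y := nth 0%N r (j + 48) in let z := nth 0%N r' j in
      [&& x != y %[mod 32], x != z %[mod 32] & y != z %[mod 32]])%N (iota 0 48))
  (iota 0 48).

Definition lower_tally (t : seq (seq nat)) (T M v : nat) : nat :=
  sumn [seq count (fun x => x %% M == v) (take (T - r) (nth [::] t r)) | r <- iota 0 T]%N.

Definition upper_tally (t : seq (seq nat)) (T M v : nat) : nat :=
  sumn [seq count (fun x => x %% M == v) (take r (drop (T - r) (nth [::] t r)))
       | r <- iota 0 T]%N.

Definition tally_check (t : seq (seq nat)) (k : nat) : bool :=
  let T := (12 * 2 ^ k)%N in let M := (2 ^ k)%N in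
  let lo := lower_tally t T M 0 in let up := upper_tally t T M 0 in
  all (fun v => (lower_tally t T M v == lo) && (upper_tally t T M v == up)) (iota 0 M).

Definition table_check : bool :=
  let t := table64 in
  [&& growth_check t, slope_check t & all (tally_check t) (iota 1 4)].

Lemma table_checkP : table_check.
Proof. by vm_compute. Qed.

Opaque table64 dyadic.

Lemma table_checkE :
  [/\ growth_check table64, slope_check table64
    & forall k, (0 < k < 5)%N -> tally_check table64 k].
Proof.
have /and3P[-> -> /allP tally] := table_checkP.
by split=> // k k15; apply: tally; rewrite mem_iota; lia.
Qed.

Lemma entry64P i j : (i < 200)%N -> (i + j < 384)%N ->
  (64 %| dyadic i j - (entry64 i j)%:Z)%Z.
Proof. by move=> i200 ij; have [] := row64P i200 ij. Qed.

Lemma dvdz_sub_nat (M x y : nat) :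
  (M%:Z %| x%:Z - y%:Z)%Z = (x == y %[mod M])%N.
Proof. by rewrite -eqz_mod_dvd !modz_nat eqz_nat. Qed.

Lemma regular_shift_dvd (M : int) (s : nat -> nat -> int) p q : regular s ->
    (forall j, (j < 10)%N -> (M %| s p (j + q)%N - s 0%N j)%Z) ->
  forall i j, (M %| s (i + p)%N (j + q)%N - s i j)%Z.
Proof.
move=> sreg; exact: regular_dvd (regular_sub (regular_shift p q sreg) sreg).
Qed.

Definition row_slope (i j : nat) : int := dyadic i (j + 48) - dyadic i j.
Definition column_slope (i j : nat) : int := dyadic (i + 48) j - dyadic i j.

Lemma row_slope_regular : regular row_slope.
Proof.
have := regular_sub (regular_shift 0 48 dyadic_regular) dyadic_regular.
by case=> P R; split=> i j; [have := P i j | have := R i j];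
   rewrite /row_slope !addn0.
Qed.

Lemma column_slope_regular : regular column_slope.
Proof.
have := regular_sub (regular_shift 48 0 dyadic_regular) dyadic_regular.
by case=> P R; split=> i j; [have := P i j | have := R i j];
   rewrite /column_slope !addn0.
Qed.

Lemma growth_check_entry j : (j < 10)%N -> let e := entry64 in
  [&& e 0 (j + 48) == e 0 j %[mod 4], e 48 j == e 0 j %[mod 4],
     e 0 (j + 96) + e 0 j == 2 * e 0 (j + 48) %[mod 64],
     e 48 (j + 48) + e 0 j == e 48 j + e 0 (j + 48) %[mod 64]
   & e 96 j + e 0 j == 2 * e 48 j %[mod 64]]%N.
Proof.
move=> j10; have [/allP G _ _] := table_checkE.
by apply: (G j); rewrite mem_iota.
Qed.

Lemma slope_check_entry i j : (i < 48)%N -> (j < 48)%N -> let e := entry64 in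
  [&& e i j != e i (j + 48) %[mod 32], e i j != e (i + 48) j %[mod 32]
    & e i (j + 48) != e (i + 48) j %[mod 32]]%N.
Proof.
move=> i48 j48; have [_ /allP G _] := table_checkE.
have i_in : i \in iota 0 48 by rewrite mem_iota.
by apply: (allP (G i i_in) j); rewrite mem_iota.
Qed.

Lemma growth_checkE j : (j < 10)%N ->
  [/\ (4 %| row_slope 0 j)%Z, (4 %| column_slope 0 j)%Z,
      (64 %| row_slope 0 (j + 48) - row_slope 0 j)%Z,
      (64 %| row_slope 48 j - row_slope 0 j)%Z
    & (64 %| column_slope 48 j - column_slope 0 j)%Z].
Proof.
move=> j10; have /= /and5P[] := growth_check_entry j10; rewrite -!dvdz_sub_nat.
have e k l : (k < 200)%N -> (l < 150)%N -> (64 %| dyadic k l - (entry64 k l)%:Z)%Z.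
  by move=> ? ?; apply: entry64P; lia.
rewrite /row_slope /column_slope -!addnA !add0n.
rewrite -[(48 + 48)%N]/96%N.
have [j0 j48 j96] : [/\ j < 150, j + 48 < 150 & j + 96 < 150]%N by split; lia.
have /dvdzP[a A] := e 0%N j isT j0; have /dvdzP[b B] := e 0%N (j + 48)%N isT j48.
have /dvdzP[c C] := e 0%N (j + 96)%N isT j96; have /dvdzP[d D] := e 48%N j isT j0.
have /dvdzP[f F] := e 48%N (j + 48)%N isT j48; have /dvdzP[g G] := e 96%N j isT j0.
move=> /dvdzP[x1 X1] /dvdzP[x2 X2] /dvdzP[x3 X3] /dvdzP[x4 X4] /dvdzP[x5 X5].
split; apply/dvdzP.
- by exists (x1 + 16 * (b - a)); lia.
- by exists (x2 + 16 * (d - a)); lia.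
- by exists (x3 + c - 2 * b + a); lia.
- by exists (x4 + f - b - d + a); lia.
- by exists (x5 + g - 2 * d + a); lia.
Qed.

Lemma slope_checkE i j : (i < 48)%N -> (j < 48)%N ->
  [/\ ~~ (32 %| row_slope i j)%Z, ~~ (32 %| column_slope i j)%Z
    & ~~ (32 %| column_slope i j - row_slope i j)%Z].
Proof.
move=> i48 j48; have /= /and3P[] := slope_check_entry i48 j48; rewrite -!dvdz_sub_nat.
have e k l : (k < 96)%N -> (l < 96)%N -> (64 %| dyadic k l - (entry64 k l)%:Z)%Z.
  by move=> ? ?; apply: entry64P; lia.
have [i0 j0 iT jT] : [/\ i < 96, j < 96, i + 48 < 96 & j + 48 < 96]%N by split; lia.
have /dvdzP[a A] := e i j i0 j0; have /dvdzP[b B] := e i (j + 48)%N i0 jT.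
have /dvdzP[c C] := e (i + 48)%N j iT j0.
rewrite /row_slope /column_slope => X Y Z; split.
- by apply: contra X => /dvdzP[x W]; apply/dvdzP; exists (2 * (b - a) - x); lia.
- by apply: contra Y => /dvdzP[x W]; apply/dvdzP; exists (2 * (c - a) - x); lia.
- by apply: contra Z => /dvdzP[x W]; apply/dvdzP; exists (2 * (c - b) - x); lia.
Qed.

Lemma slope_dvd4 i j : (4 %| row_slope i j)%Z /\ (4 %| column_slope i j)%Z.
Proof.
by split; [apply: regular_dvd row_slope_regular _ _ _
          | apply: regular_dvd column_slope_regular _ _ _];
   move=> k k10; have [] := growth_checkE k10.
Qed.

Lemma slope_commute i j :
  row_slope (i + 48) j - row_slope i j = column_slope i (j + 48) - column_slope i j.
Proof. by rewrite /row_slope /column_slope; ring. Qed.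

Lemma row_slope_period a b i j :
  (64 %| row_slope (i + 48 * a) (j + 48 * b) - row_slope i j)%Z.
Proof.
apply: dvdz_multiples => {a b i j} i j.
  rewrite -[j in row_slope (_ + _) j]addn0.
  apply: regular_shift_dvd row_slope_regular _ _ _ => k k10.
  by have [] := growth_checkE k10; rewrite addn0.
rewrite -[i in row_slope i (_ + _)]addn0.
apply: regular_shift_dvd row_slope_regular _ _ _ => k k10.
by have [] := growth_checkE k10.
Qed.

Lemma column_slope_period a b i j :
  (64 %| column_slope (i + 48 * a) (j + 48 * b) - column_slope i j)%Z.
Proof.
apply: dvdz_multiples => {a b i j} i j; last first.
  (* The mixed second difference was already handled for [row_slope]. *)
  by rewrite -slope_commute; have := row_slope_period 1 0 i j; rewrite addn0.
rewrite -[j in column_slope (_ + _) j]addn0.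
apply: regular_shift_dvd column_slope_regular _ _ _ => k k10.
by have [] := growth_checkE k10; rewrite addn0.
Qed.

Lemma slope_ndvd32 i j :
  [/\ ~~ (32 %| row_slope i j)%Z, ~~ (32 %| column_slope i j)%Z
    & ~~ (32 %| column_slope i j - row_slope i j)%Z].
Proof.
have [] := slope_checkE (ltn_pmod i (isT : 0 < 48)%N) (ltn_pmod j (isT : 0 < 48)%N).
have := row_slope_period (i %/ 48) (j %/ 48) (i %% 48) (j %% 48).
have := column_slope_period (i %/ 48) (j %/ 48) (i %% 48) (j %% 48).
rewrite ![(_ %% 48 + 48 * _)%N]addnC ![(48 * _)%N]mulnC -!divn_eq.
move=> /dvdzP[a A] /dvdzP[b B] X Y Z; split.
- by apply: contra X => /dvdzP[x W]; apply/dvdzP; exists (x - 2 * b); lia.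
- by apply: contra Y => /dvdzP[x W]; apply/dvdzP; exists (x - 2 * a); lia.
- by apply: contra Z => /dvdzP[x W]; apply/dvdzP; exists (x - 2 * (a - b)); lia.
Qed.

Lemma row_growth n i j :
  (2 ^+ (n + 5) %| dyadic i (j + 48 * 2 ^ n)%N - dyadic i j - 2 ^+ n * row_slope i j)%Z.
Proof.
have := @regular_growth dyadic 0 1 dyadic_regular; rewrite !muln0 !muln1.
move=> /(_ _ _ n i j); rewrite muln0 addn0 muln1; apply=> {i j} i j.
  by rewrite addn0; have [] := slope_dvd4 i j.
have := row_slope_period 0 1 i j; rewrite !addn0 /row_slope -addnA.
by congr (_ %| _)%Z; ring.
Qed.

Lemma column_growth n i j :
  (2 ^+ (n + 5) %| dyadic (i + 48 * 2 ^ n)%N j - dyadic i j - 2 ^+ n * column_slope i j)%Z.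
Proof.
have := @regular_growth dyadic 1 0 dyadic_regular; rewrite !muln0 !muln1.
move=> /(_ _ _ n i j); rewrite muln0 addn0 muln1; apply=> {i j} i j.
  by rewrite addn0; have [] := slope_dvd4 i j.
have := column_slope_period 1 0 i j; rewrite !addn0 /column_slope -addnA.
by congr (_ %| _)%Z; ring.
Qed.

(** * Powers of two *)

(** The slopes are constant modulo 64 along the lattice of step 48, so after multiplication by 2^n
    they are constant modulo 2^(n+5) and every lattice step adds the same amount. *)
Lemma dyadic_lattice n k l i j :
  (2 ^+ (n + 5) %| dyadic (i + 48 * 2 ^ n * k) (j + 48 * 2 ^ n * l)
     - (dyadic i j + k%:Z * (2 ^+ n * column_slope i j) + l%:Z * (2 ^+ n * row_slope i j)))%Z.
Proof.
have scale d d' : (64 %| d - d')%Z -> (2 ^+ (n + 5) %| 2 ^+ n * d - 2 ^+ n * d')%Z.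
  by case/dvdzP=> c dd'; apply/dvdzP; exists (2 * c); rewrite exprD -mulrBr dd'; ring.
have Mi : (2 ^+ (n + 5) %| dyadic (i + 48 * 2 ^ n * k) j - dyadic i j
    - k%:Z * (2 ^+ n * column_slope i j))%Z.
  have := @dvdz_progression (2 ^+ (n + 5)) (2 ^+ n * column_slope i j)
    (fun k => dyadic (i + 48 * 2 ^ n * k) j).
  rewrite muln0 addn0; apply=> {}k; rewrite mulnSr addnA.
  have := rpredD (column_growth n (i + 48 * 2 ^ n * k) j)
                 (scale _ _ (column_slope_period (2 ^ n * k) 0 i j)).
  by rewrite muln0 addn0 mulnA; congr (_ %| _)%Z; ring.
have Mj : (2 ^+ (n + 5) %| dyadic (i + 48 * 2 ^ n * k) (j + 48 * 2 ^ n * l)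
    - dyadic (i + 48 * 2 ^ n * k) j - l%:Z * (2 ^+ n * row_slope i j))%Z.
  have := @dvdz_progression (2 ^+ (n + 5)) (2 ^+ n * row_slope i j)
    (fun l => dyadic (i + 48 * 2 ^ n * k) (j + 48 * 2 ^ n * l)).
  rewrite muln0 addn0; apply=> {}l; rewrite [(_ * l.+1)%N]mulnSr addnA.
  have := rpredD (row_growth n (i + 48 * 2 ^ n * k) (j + 48 * 2 ^ n * l))
                 (scale _ _ (row_slope_period (2 ^ n * k) (2 ^ n * l) i j)).
  by rewrite !mulnA; congr (_ %| _)%Z; ring.
by have := rpredD Mi Mj; congr (_ %| _)%Z; ring.
Qed.

(** Write d = 4 e with e not divisible by 8: then 4 is a multiple of e modulo 8, with factor 4, 2 or
    1 according to the power of 2 in e. *)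
Lemma full_direction_pow2 (n N : nat) (d : int) : (4 %| d)%Z -> ~~ (32 %| d)%Z ->
  full_direction (2 ^+ (n + 5)) (2 ^+ (n + 4)) (8 * N) (2 ^+ n * d).
Proof.
case/dvdzP=> e -> ndvd; split.
  by apply/dvdzP; exists (N%:Z * e); rewrite exprD PoszM; ring.
suff [w /dvdzP[c we]] : exists w : nat, (8 %| w%:Z * e - 4)%Z.
  exists w; apply/dvdzP; exists c; rewrite !exprD.
  have -> : w%:Z * (2 ^+ n * (e * 4)) - 2 ^+ n * 2 ^+ 4
          = 2 ^+ n * 4 * (w%:Z * e - 4) by ring.
  by rewrite we; ring.
have odd_half x : ~~ (2 %| x)%Z -> exists y, x = y * 2 + 1.
  by move=> odd_x; exists (x %/ 2)%Z; lia.
have [/dvdzP[f ef]|/odd_half[f ef]] := boolP (2 %| e)%Z; last first.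
  by exists 4%N; apply/dvdzP; exists f; lia.
have [/dvdzP[g fg]|/odd_half[g fg]] := boolP (2 %| f)%Z; last first.
  by exists 2%N; apply/dvdzP; exists g; lia.
have [/dvdzP[c gc]|/odd_half[c gc]] := boolP (2 %| g)%Z; last first.
  by exists 1%N; apply/dvdzP; exists c; lia.
by case/negP: ndvd; apply/dvdzP; exists c; lia.
Qed.

(** Modulo 2 this is the period 24; from modulus 4 on, it is the growth formula with slopes
    divisible by 4. *)
Lemma dyadic_period k i j :
  (2 ^+ k %| dyadic i (j + 12 * 2 ^ k) - dyadic i j)%Z /\
  (2 ^+ k %| dyadic (i + 12 * 2 ^ k) j - dyadic i j)%Z.
Proof.
case: k => [|[|k]]; first by rewrite expr0 !dvd1z.
  have := regular_period2 dyadic_regular 0 1 i j; have := regular_period2 dyadic_regular 1 0 i j.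
  by rewrite !addn0.
have := row_growth k i j; have := column_growth k i j; have [] := slope_dvd4 i j.
rewrite (_ : 12 * 2 ^ k.+2 = 48 * 2 ^ k)%N; last by rewrite !expnS; lia.
rewrite exprD -(addn2 k) exprD => /dvdzP[a A] /dvdzP[b B] /dvdzP[c C] /dvdzP[d D].
split; apply/dvdzP.
  by exists (8 * d + a); rewrite -(subrK (2 ^+ k * row_slope i j) (_ - _)) D A; ring.
by exists (8 * c + b); rewrite -(subrK (2 ^+ k * column_slope i j) (_ - _)) C B; ring.
Qed.

Lemma pow2_nat k : 2 ^+ k = (2 ^ k)%N%:Z :> int.
Proof. by elim: k => //= k IH; rewrite exprS IH expnS PoszM. Qed.

Lemma residue_tally (k i j v : nat) : (k < 5)%N -> (i < 200)%N -> (i + j < 384)%N ->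
  (v < 2 ^ k)%N ->
  (2 ^+ k %| dyadic i j - v%:Z)%Z = (entry64 i j %% 2 ^ k == v)%N.
Proof.
move=> k5 i200 ij v_lt; rewrite (@dvdz_congr _ _ ((entry64 i j)%:Z - v%:Z)).
  by rewrite pow2_nat dvdz_sub_nat [in X in _ == X]modn_small.
have -> : dyadic i j - v%:Z - ((entry64 i j)%:Z - v%:Z) = dyadic i j - (entry64 i j)%:Z by ring.
apply: dvdz_trans (entry64P i200 ij).
by rewrite (_ : 64 = 2 ^+ 6) // dvdz_exp2l //; lia.
Qed.

Lemma count_segment (r : seq nat) (a : pred nat) p n : (p + n <= size r)%N ->
  count a (take n (drop p r)) = (\sum_(j < n) a (nth 0 r (p + j)))%N.
Proof.
move=> pn; rewrite -(@map_nth_iota _ 0%N); last by lia.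
rewrite count_map -sum1_count big_mkcond /= -[p in iota p]addn0 iotaDl big_map.
by rewrite -[n in iota 0 n]subn0 big_mkord; apply: eq_bigr => j _; case: ifP.
Qed.

Lemma lower_tallyE k v : (k < 5)%N -> (v < 2 ^ k)%N ->
  lower_count (2 ^+ k) dyadic (12 * 2 ^ k) v%:Z
  = (lower_tally table64 (12 * 2 ^ k) (2 ^ k) v)%:Z.
Proof.
move=> k5 v_lt; have T192 : (12 * 2 ^ k <= 192)%N.
  by rewrite (_ : 192 = 12 * 2 ^ 4)%N // leq_mul2l leq_pexp2l //; lia.
rewrite /lower_tally sumnE big_map -[X in iota 0 X]subn0 big_mkord.
rewrite /lower_count (big_morph Posz PoszD (erefl 0)).
apply: eq_bigr => r _; have r_lt := ltn_ord r.
have [r200 r384] : (r < 200)%N /\ (r + 0 < 384)%N by split; lia.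
have [sz _] := row64P r200 r384.
rewrite -[nth _ _ r]drop0 count_segment ?sz; last by lia.
rewrite (big_morph Posz PoszD (erefl 0)).
rewrite (sum_truncate (n := 12 * 2 ^ k) (p := 12 * 2 ^ k - r)
  (fun c => (nth 0%N (nth [::] table64 r) (0 + c) %% 2 ^ k == v)%N%:Z)) ?leq_subr //.
apply: eq_bigr => c _; have c_lt := ltn_ord c.
rewrite residue_tally ?add0n //; last by lia.
by rewrite /entry64; congr (_ *+ nat_of_bool _); lia.
Qed.

Lemma upper_tallyE k v : (k < 5)%N -> (v < 2 ^ k)%N ->
  upper_count (2 ^+ k) dyadic (12 * 2 ^ k) v%:Z
  = (upper_tally table64 (12 * 2 ^ k) (2 ^ k) v)%:Z.
Proof.
move=> k5 v_lt; have T192 : (12 * 2 ^ k <= 192)%N.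
  by rewrite (_ : 192 = 12 * 2 ^ 4)%N // leq_mul2l leq_pexp2l //; lia.
rewrite /upper_tally sumnE big_map -[X in iota 0 X]subn0 big_mkord.
rewrite /upper_count (big_morph Posz PoszD (erefl 0)).
apply: eq_bigr => r _; have r_lt := ltn_ord r.
have [r200 r384] : (r < 200)%N /\ (r + 0 < 384)%N by split; lia.
have [sz _] := row64P r200 r384.
rewrite count_segment ?sz; last by lia.
rewrite (big_morph Posz PoszD (erefl 0)).
set T := (12 * 2 ^ k)%N in T192 r_lt *.
pose g c := (nth 0%N (nth [::] table64 r) c %% 2 ^ k == v)%N%:Z.
transitivity (\sum_(c < T) g c *+ (T <= r + c)%N).
  apply: eq_bigr => c _; have c_lt := ltn_ord c.
  by rewrite residue_tally //; lia.
rewrite -(big_mkord xpredT (fun c => g c *+ (T <= r + c)%N)).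
rewrite (@big_cat_nat _ _ _ (T - r)) ?leq_subr //= big_nat big1 ?add0r => [|c c_lt].
  rewrite -[X in \sum_(X <= _ < _) _]add0n big_addn (subKn (ltnW r_lt)).
  rewrite big_mkord; apply: eq_bigr => c _.
  by rewrite addnC /g (_ : (T <= _)%N) ?mulr1n //; lia.
by rewrite (_ : (T <= r + c)%N = false) ?mulr0n //; lia.
Qed.

Lemma equidistributed_pow2_small k N : (0 < k < 5)%N ->
  equidistributed (2 ^+ k) dyadic (12 * 2 ^ k * N).
Proof.
case/andP=> k_gt0 k5.
have [_ _ /(_ k)] := table_checkE; rewrite k_gt0 k5 => /(_ isT)/allP tally.
have tallyE v : (v < 2 ^ k)%N ->
    lower_count (2 ^+ k) dyadic (12 * 2 ^ k) v%:Z
      = lower_count (2 ^+ k) dyadic (12 * 2 ^ k) 0 /\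
    upper_count (2 ^+ k) dyadic (12 * 2 ^ k) v%:Z
      = upper_count (2 ^+ k) dyadic (12 * 2 ^ k) 0.
  move=> v_lt; have v_in : v \in iota 0 (2 ^ k) by rewrite mem_iota.
  have /andP[/eqP lo /eqP up] := tally v v_in.
  have pow_gt0 : (0 < 2 ^ k)%N by rewrite expn_gt0.
  by rewrite !lower_tallyE // !upper_tallyE // lo up.
(* Counts depend on [v] only modulo 2^k, while the tallies cover v < 2^k. *)
have reduce f : (forall v, f (v %% (2 ^+ k))%Z = f v) ->
    (forall v, (v < 2 ^ k)%N -> f v%:Z = f 0) -> forall v w : int, f v = f w :> int.
  move=> fM f0; suff f0' v : f v = f 0 by move=> v w; rewrite !f0'.
  have pow_gt0 : (0 < 2 ^+ k :> int) by rewrite exprn_gt0.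
  have := modz_ge0 v (lt0r_neq0 pow_gt0); have := ltz_pmod v pow_gt0.
  by rewrite -fM; case: (v %% _)%Z => // n; rewrite pow2_nat => n_lt _; apply: f0.
have indicator_modz x v : ((2 ^+ k %| x - (v %% 2 ^+ k)%Z)%Z = (2 ^+ k %| x - v)%Z).
  apply: dvdz_congr; apply/dvdzP; exists (v %/ 2 ^+ k)%Z.
  by have := divz_eq v (2 ^+ k); lia.
apply: equidistributed_periodic => [i j|i j||].
- by have [] := dyadic_period k i j.
- by have [] := dyadic_period k i j.
- apply: reduce => v; last by case/tallyE.
  by rewrite /lower_count; do 2![apply: eq_bigr => ? _]; rewrite indicator_modz.
- apply: reduce => v; last by case/tallyE.
  by rewrite /upper_count; do 2![apply: eq_bigr => ? _]; rewrite indicator_modz.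
Qed.

Lemma equidistributed_pow2 k N : equidistributed (2 ^+ k) dyadic (12 * 2 ^ k * N).
Proof.
elim: k N => [|k IH] N.
  by move=> v w; rewrite /residue_count /triangle_sum; do 2![apply: eq_bigr => ? _];
     rewrite !dvd1z.
have [k_small|k_large] := ltnP k 4; first exact: equidistributed_pow2_small.
have powS : 2 ^+ k.+1 = 2 ^+ k * 2%N%:Z :> int by rewrite exprSr.
rewrite powS; apply: equidistributed_lift => //.
- by rewrite expf_neq0.
- by rewrite expnS (_ : 12 * (2 * 2 ^ k) * N = 12 * 2 ^ k * (2 * N))%N //; lia.
move=> w; rewrite -powS {powS}.
(* With k = n + 4, the lift goes from 2^(n+4) to 2^(n+5), and the side consists of 8 N lattice steps
   of length 48 2^n. *)
have [n kE] : exists n, k = (n + 4)%N by exists (k - 4)%N; rewrite subnK.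
rewrite {k IH k_large}kE -addnS (_ : 12 * 2 ^ (n + 5) * N = 48 * 2 ^ n * (8 * N))%N; last first.
  by rewrite expnD; lia.
apply: (@residue_count_shift _ _ dyadic (fun i j => 2 ^+ n * column_slope i j)
                                 (fun i j => 2 ^+ n * row_slope i j)).
  move=> r c k l _ _; rewrite [(_ * k + r)%N]addnC [(_ * l + c)%N]addnC.
  exact: dyadic_lattice.
move=> r c _ _; have [d4 e4] := slope_dvd4 r c; have [d32 e32 de32] := slope_ndvd32 r c.
split; rewrite -?mulrBr; apply: full_direction_pow2 => //.
by rewrite rpredB.
Qed.

(** * The odd part *)

(* The row 0, -1, 1, 1, -3, 2, 2, -5, 3, ... interlaces three arithmetic
   progressions; all its derived rows have the same shape. *)
Fixpoint universal_row (x : int) (j : nat) : int :=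
  match j with
  | 0%N => x
  | 1%N => - (2 * x + 1)
  | 2%N => x + 1
  | j'.+3 => universal_row (x + 1) j'
  end.

Fixpoint universal (i j : nat) : int :=
  if i is i'.+1 then universal i' j + universal i' j.+1 else universal_row 0 j.

(* The rows are combinations of the powers of the primitive cube roots of unity. *)
Definition omega_array (s : nat -> nat -> int) :=
  pascal s /\ forall i j, s i j + s i j.+1 + s i j.+2 = 0.

Lemma omega_array_sub s t : omega_array s -> omega_array t ->
  omega_array (fun i j => s i j - t i j).
Proof.
move=> [sP s0] [tP t0]; split=> i j; first by rewrite sP tP; ring.
by have := s0 i j; have := t0 i j; lia.
Qed.

(** Rows have period 3 and the next row is the negative of the row shifted by 2, so up to sign only
    the first three entries occur. *)
Lemma omega_array_ind (s : nat -> nat -> int) (P : int -> Prop) :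
    omega_array s -> (forall x, P x -> P (- x)) ->
    (forall j, (j < 3)%N -> P (s 0%N j)) ->
  forall i j, P (s i j).
Proof.
move=> [sP s0] PN P0; elim=> [|i IH] j; last first.
  by rewrite sP (_ : _ + _ = - s i j.+2); [exact: PN | have := s0 i j; lia].
elim/ltn_ind: j => j IH; have [/P0 //|j_ge] := ltnP j 3.
have -> : s 0%N j = s 0%N (j - 3)%N; last by apply: IH; lia.
have := s0 0%N (j - 3)%N; have := s0 0%N (j - 3).+1.
by rewrite (_ : (j - 3).+3 = j); lia.
Qed.

(** The row shift satisfies x^3 = 1, and going down is multiplication by 1 + x = -x^2, whose sixth
    power is 1. *)
Lemma omega_array_period (s : nat -> nat -> int) : omega_array s ->
  forall i j, s i (j + 12)%N = s i j /\ s (i + 12)%N j = s i j.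
Proof.
move=> [sP s0].
have s3 i j : s i j.+3 = s i j by have := s0 i j; have := s0 i j.+1; lia.
have sS i j : s i.+1 j = - s i j.+2 by rewrite sP; have := s0 i j; lia.
by move=> i j; rewrite !addnS !addn0 !sS !s3 !opprK.
Qed.

(** The characteristic polynomial is (x^2 + x + 1)^2. *)
Lemma universal_row_rec x j :
  let u := universal_row x in
  u j + 2 * u j.+1 + 3 * u j.+2 + 2 * u j.+3 + u j.+4 = 0.
Proof.
elim/ltn_ind: j x => -[|[|[|j]]] IH x; try by rewrite /=; ring.
have j_lt : (j < j.+3)%N by lia.
exact: (IH j j_lt (x + 1)).
Qed.

Lemma universal_rec i j : universal i j + 2 * universal i j.+1 + 3 * universal i j.+2
  + 2 * universal i j.+3 + universal i j.+4 = 0.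
Proof.
elim: i j => [|i IH] j; first exact: universal_row_rec.
by have := IH j; have := IH j.+1; rewrite /=; lia.
Qed.

Definition universal_row_step (i j : nat) : int := universal i (j + 12) - universal i j.
Definition universal_column_step (i j : nat) : int := universal (i + 12) j - universal i j.

(** Applying x^2 + x + 1 to [universal] gives an omega array, which is 12-periodic; hence x^2 + x +
    1 kills the differences over 12 steps. *)
Lemma universal_steps_omega :
  omega_array universal_row_step /\ omega_array universal_column_step.
Proof.
pose g i j := universal i j + universal i j.+1 + universal i j.+2.
have g_bal : omega_array g.
  split=> i j; first by rewrite /g /=; ring.
  by have := universal_rec i j; rewrite /g; lia.
split; split=> i j.
- by rewrite /universal_row_step /=; ring.
- have [+ _] := omega_array_period g_bal i j.
  by rewrite /g /universal_row_step !addSn; lia.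
- by rewrite /universal_column_step /=; ring.
have [_] := omega_array_period g_bal i j.
by rewrite /g /universal_column_step; lia.
Qed.

(** The three side steps take only the values 4, -4, 8 and -8. [P] will be invertibility modulo an
    odd number, after scaling by a power of 2. *)
Lemma universal_steps_pow2 (P : int -> Prop) :
    (forall x, P x -> P (- x)) -> P 4 -> P 8 ->
  forall i j, [/\ P (universal_row_step i j), P (universal_column_step i j)
    & P (universal_column_step i j - universal_row_step i j)].
Proof.
move=> PN P4 P8 i j; have [rB cB] := universal_steps_omega.
have cases x : x \in [:: 4; -4; 8; -8] -> P x.
  by rewrite !inE => /or4P[] /eqP-> //; apply: PN.
split.
- by apply: (omega_array_ind rB) => // -[|[|[|]]] //= _; apply: cases; vm_compute.
- by apply: (omega_array_ind cB) => // -[|[|[|]]] //= _; apply: cases; vm_compute.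
by apply: (omega_array_ind (omega_array_sub cB rB)) => // -[|[|[|]]] //= _;
   apply: cases; vm_compute.
Qed.

Lemma universal_lattice k l i j :
  universal (i + 12 * k) (j + 12 * l)
  = universal i j + k%:Z * universal_column_step i j + l%:Z * universal_row_step i j.
Proof.
have [rB cB] := universal_steps_omega.
have col a b : universal_column_step (a + 12 * b) j = universal_column_step a j.
  elim: b => [|b IH]; rewrite ?addn0 // mulnSr addnA.
  by have [_ ->] := omega_array_period cB (a + 12 * b)%N j.
have row a b c d : universal_row_step (a + 12 * b) (c + 12 * d) = universal_row_step a c.
  elim: d => [|d IH]; rewrite ?muln0 ?addn0.
    elim: b => [|b IH]; rewrite ?muln0 ?addn0 // mulnSr addnA.
    by have [_ ->] := omega_array_period rB (a + 12 * b)%N c.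
  by rewrite mulnSr addnA; have [-> _] := omega_array_period rB (a + 12 * b)%N (c + 12 * d)%N.
elim: l => [|l IH].
  rewrite muln0 addn0 mul0r addr0; elim: k => [|k IH]; first by rewrite muln0 addn0; ring.
  have -> : universal (i + 12 * k.+1) j
      = universal_column_step i j + universal (i + 12 * k) j.
    by rewrite -(col i k) /universal_column_step subrK mulnSr addnA.
  by rewrite IH -addn1 PoszD; ring.
have -> : universal (i + 12 * k) (j + 12 * l.+1)
    = universal_row_step i j + universal (i + 12 * k) (j + 12 * l).
  by rewrite -(row i k j l) /universal_row_step subrK mulnSr addnA.
by rewrite IH -addn1 PoszD; ring.
Qed.

(** * Combining the two arrays *)

Lemma pow2_inverse (q : nat) : odd q -> forall e, exists w : nat, (q%:Z %| w%:Z * 2 ^+ e - 1)%Z.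
Proof.
move=> q_odd; elim=> [|e [w /dvdzP[c we]]].
  by exists 1%N; rewrite subrr dvdz0.
(* [q./2 + 1] is (q + 1) / 2, the inverse of 2 modulo [q]. *)
exists (w * (q./2 + 1))%N; apply/dvdzP; exists (c + w%:Z * 2 ^+ e).
have -> : w%:Z * 2 ^+ e = c * q%:Z + 1 by rewrite -we; ring.
have qE : q%:Z = 2 * (q./2)%:Z + 1 by have := odd_double_half q; rewrite q_odd; lia.
rewrite PoszM PoszD exprS.
have -> : w%:Z * ((q./2)%:Z + 1) * (2 * 2 ^+ e) - 1
  = (w%:Z * 2 ^+ e - 1) * (q%:Z + 1) + q%:Z by rewrite qE; ring.
by rewrite we; ring.
Qed.

Lemma chinese_int (p q : nat) : coprime p q ->
  exists alpha : int, (p%:Z %| alpha - 1)%Z /\ (q%:Z %| alpha)%Z.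
Proof.
move=> co_pq; exists (chinese p q 1 0)%:Z; split.
  by rewrite dvdz_sub_nat; apply/eqP; exact: chinese_modl.
by rewrite -[_%:Z]subr0 (dvdz_sub_nat q _ 0); apply/eqP; exact: chinese_modr.
Qed.

Lemma scaled_dyadic_period (k q : nat) (alpha : int) a b i j : (q%:Z %| alpha)%Z ->
  (2 ^+ k * q%:Z %| alpha * dyadic (i + 12 * 2 ^ k * a) (j + 12 * 2 ^ k * b)
                    - alpha * dyadic i j)%Z.
Proof.
move=> q_alpha; rewrite -mulrBr [alpha * _]mulrC dvdz_mul //.
by apply: dvdz_multiples => i' j'; have [] := dyadic_period k i' j'.
Qed.

(** Modulo 2^k the array is [dyadic], which starts the lift. On the lattice of step 12 2^k the
    dyadic part is constant modulo 2^k q, so only [universal] contributes steps: 2^k times numbers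
    invertible modulo [q], whose multiples reach 2^k. *)
Lemma equidistributed_combined (k q N : nat) (alpha : int) :
    odd q -> (2 ^+ k %| alpha - 1)%Z -> (q%:Z %| alpha)%Z ->
  equidistributed (2 ^+ k * q%:Z)
    (fun i j => alpha * dyadic i j + 2 ^+ k * universal i j) (12 * 2 ^ k * (q * N)).
Proof.
move=> q_odd alpha1 alpha0; have q_gt0 : (0 < q)%N by case: q q_odd {alpha0}.
apply: equidistributed_lift => //; first by rewrite expf_neq0.
  move=> v w; have reduce x : residue_count (2 ^+ k)
      (fun i j => alpha * dyadic i j + 2 ^+ k * universal i j) (12 * 2 ^ k * (q * N)) x
    = residue_count (2 ^+ k) dyadic (12 * 2 ^ k * (q * N)) x.
    apply: eq_bigr => i _; apply: eq_bigr => j _; congr (nat_of_bool _)%:Z.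
    apply: dvdz_congr; case/dvdzP: alpha1 => c alphaE; apply/dvdzP.
    exists (c * dyadic i j + universal i j).
    by rewrite -(subrK 1 alpha) alphaE; ring.
  by rewrite !reduce; exact: equidistributed_pow2.
apply: (@residue_count_shift _ _ _
  (fun i j => 2 ^+ k * (2 ^+ k * universal_column_step i j))
  (fun i j => 2 ^+ k * (2 ^+ k * universal_row_step i j))).
  move=> r c a b _ _; rewrite [(_ * a + r)%N]addnC [(_ * b + c)%N]addnC.
  have dyadicP := scaled_dyadic_period k a b r c alpha0.
  have UE : universal (r + 12 * 2 ^ k * a) (c + 12 * 2 ^ k * b) = universal r c
      + a%:Z * (2 ^+ k * universal_column_step r c) + b%:Z * (2 ^+ k * universal_row_step r c).
    by rewrite -!mulnA universal_lattice !PoszM -pow2_nat; ring.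
  by move: dyadicP; rewrite UE; congr (_ %| _)%Z; ring.
move=> r c _ _.
pose Q x := exists w : nat, (q%:Z %| w%:Z * (2 ^+ k * x) - 1)%Z.
have QP x : Q x ->
    full_direction (2 ^+ k * q%:Z) (2 ^+ k) (q * N) (2 ^+ k * (2 ^+ k * x)).
  case=> w /dvdzP[e we]; split.
    by apply/dvdzP; exists (N%:Z * (2 ^+ k * x)); rewrite PoszM; ring.
  exists w; apply/dvdzP; exists e.
  have -> : w%:Z * (2 ^+ k * (2 ^+ k * x)) - 2 ^+ k
          = 2 ^+ k * (w%:Z * (2 ^+ k * x) - 1) by ring.
  by rewrite we; ring.
have QN x : Q x -> Q (- x).
  (* [q.-1] serves as -1 modulo [q], keeping the witness natural. *)
  case=> w /dvdzP[e we]; exists (w * q.-1)%N; apply/dvdzP.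
  exists (e - w%:Z * (2 ^+ k * x)).
  have q1 : q.-1%:Z = q%:Z - 1 by lia.
  have -> : (w * q.-1)%N%:Z * (2 ^+ k * - x) - 1
      = (w%:Z * (2 ^+ k * x) - 1) - w%:Z * (2 ^+ k * x) * q%:Z.
    by rewrite PoszM q1; ring.
  by rewrite we; ring.
have Qpow e : Q (2 ^+ e).
  by have [w] := pow2_inverse q_odd (k + e); rewrite exprD; exists w.
have [Qr Qc Qcr] := universal_steps_pow2 QN (Qpow 2%N) (Qpow 3%N) r c.
by split; rewrite -?mulrBr; apply: QP.
Qed.

(** * Repeated tuples and Steinhaus triangles *)

Lemma nth_rep_seq (T : Type) (x0 : T) (lambda : nat) (s : seq T) (j : nat) :
  (j < lambda * size s)%N -> nth x0 (rep_seq lambda s) j = nth x0 s (j %% size s).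
Proof.
rewrite /rep_seq; elim: lambda j => [|l IH] j; first by rewrite mul0n.
rewrite mulSn /= nth_cat => j_lt; have [/modn_small-> //|j_ge] := ltnP j (size s).
by rewrite IH ?ltn_subLR // -[in RHS](subnK j_ge) modnDr.
Qed.

Lemma size_rep_seq (T : Type) (lambda : nat) (s : seq T) :
  size (rep_seq lambda s) = (lambda * size s)%N.
Proof. by elim: lambda => //= l IH; rewrite /rep_seq /= size_cat -/(rep_seq l s) IH mulSn. Qed.

Lemma count_steinhaus_entries (m : nat) (s : nat -> nat -> int) (t : seq nat) (x : nat) :
    (x < m)%N -> pascal s ->
    (forall j, (j < size t)%N -> (nth 0%N t j)%:Z = (s 0%N j %% m)%Z) ->
  (count_mem x (steinhaus_entries m t))%:Z = residue_count m s (size t) x.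
Proof.
move=> x_lt sP t0.
have entryE i j : (i + j < size t)%N ->
    (steinhaus_entry m t i j)%:Z = (s i j %% m)%Z.
  elim: i j => [|i IH] j ij; first exact: t0.
  rewrite /= sP -modzDm -(IH j (ltnW ij)) -(IH j.+1); last by rewrite addnS.
  by rewrite -PoszD modz_nat.
rewrite /steinhaus_entries count_flatten -map_comp sumnE big_map.
rewrite -[X in iota 0 X]subn0 big_mkord (big_morph Posz PoszD (erefl 0)).
apply: eq_bigr => i _ /=; rewrite count_map -sum1_count big_mkcond /=.
rewrite -[X in iota 0 X]subn0 big_mkord (big_morph Posz PoszD (erefl 0)).
apply: eq_bigr => j _; have ij : (i + j < size t)%N by have := ltn_ord j; lia.
rewrite -eqz_mod_dvd -(entryE i j ij) modz_nat modn_small //= eqz_nat.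
Qed.

(** Row 0 of the combined array has period 12 m modulo [m]. The tuple is one period, so its
    repetitions are initial segments of that row. *)
Lemma balanced_tuple (m : nat) : (0 < m)%N ->
  exists A : (12 * m).-tuple 'I_m,
    forall lambda : nat, balanced_steinhaus (rep_seq lambda (tval A)).
Proof.
move=> m_gt0; pose k := logn 2 m; pose q := (m`_2^')%N.
have mE : m = (2 ^ k * q)%N by rewrite /k /q -p_part partnC.
have q_odd : odd q.
  by rewrite -[odd q]negbK -dvdn2 -prime.p'natE ?part_pnat.
have mZ : m%:Z = 2 ^+ k * q%:Z by rewrite {1}mE PoszM pow2_nat.
have [alpha [alpha1 alpha0]] : 
    exists alpha : int, (2 ^+ k %| alpha - 1)%Z /\ (q%:Z %| alpha)%Z.
  by rewrite pow2_nat; apply: chinese_int; rewrite coprimeXl // coprime2n.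
pose s i j := alpha * dyadic i j + 2 ^+ k * universal i j.
have sP : pascal s.
  by move=> i j; have [bP _] := dyadic_regular; rewrite /s bP /=; ring.
have s_period j : (s 0%N (j + 12 * m)%N %% m)%Z = (s 0%N j %% m)%Z.
  apply/eqP; rewrite eqz_mod_dvd mZ /s mE.
  have := scaled_dyadic_period k 0 q 0 j alpha0; rewrite muln0 addn0 -mulnA => dyadicP.
  have := universal_lattice 0 (2 ^ k * q) 0 j; rewrite muln0 addn0 mul0r addr0 => ->.
  have -> : alpha * dyadic 0 (j + 12 * (2 ^ k * q))
      + 2 ^+ k * (universal 0 j + (2 ^ k * q)%N%:Z * universal_row_step 0 j)
      - (alpha * dyadic 0 j + 2 ^+ k * universal 0 j)
    = (alpha * dyadic 0 (j + 12 * (2 ^ k * q)) - alpha * dyadic 0 j)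
      + 2 ^+ k * universal_row_step 0 j * (2 ^ k * q)%N%:Z by ring.
  by rewrite rpredD // PoszM -pow2_nat dvdz_mull.
have mod_lt j : (`|(s 0%N j %% m)%Z| < m)%N.
  have m0 : m%:Z != 0 by rewrite eqz_nat -lt0n.
  by have := modz_ge0 (s 0%N j) m0; have := ltz_pmod (s 0%N j) (_ : 0 < m%:Z); lia.
exists [tuple Ordinal (mod_lt j) | j < 12 * m] => lambda.
exists `|residue_count m s (12 * m * lambda) 0|%N => x.
set A := tval _; set t := map val _.
have szA : size A = (12 * m)%N by rewrite size_tuple.
have szt : size t = (12 * m * lambda)%N.
  by rewrite size_map size_rep_seq szA mulnC.
apply/eqP; rewrite -eqz_nat (@count_steinhaus_entries _ s) // => [|j]; last first.
  rewrite szt => j_lt.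
  rewrite (nth_map (Ordinal (mod_lt 0%N))) ?size_rep_seq ?szA ?[(lambda * _)%N]mulnC //.
  rewrite nth_rep_seq ?szA ?[(lambda * _)%N]mulnC //.
  have jm : (j %% (12 * m) < 12 * m)%N by rewrite ltn_pmod // muln_gt0.
  rewrite -[(j %% _)%N]/(nat_of_ord (Ordinal jm)) -tnth_nth tnth_mktuple /=.
  rewrite gez0_abs ?modz_ge0 // ?eqz_nat -?lt0n //.
  have periods e r : (s 0%N (r + 12 * m * e)%N %% m)%Z = (s 0%N r %% m)%Z.
    by elim: e => [|e IH]; rewrite ?muln0 ?addn0 // mulnSr addnA s_period.
  by rewrite [in RHS](divn_eq j (12 * m)) addnC [(_ %/ _ * _)%N]mulnC periods.
rewrite szt gez0_abs; last by do 2![apply: sumr_ge0 => ? _].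
have lenE : (12 * m * lambda = 12 * 2 ^ k * (q * lambda))%N by rewrite mE !mulnA.
by apply/eqP; rewrite mZ lenE; apply: equidistributed_combined.
Qed.

Local Close Scope ring_scope.


Theorem theorem1 :
  forall m : nat, 0 < m ->
  exists A : (12 * m).-tuple 'I_m,
    forall lambda : nat, balanced_steinhaus (rep_seq lambda (tval A)).
Proof. exact: balanced_tuple. Qed.
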